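(* Let $(a_n)_{n\ge 0}$ be the Somos-5 sequence, defined by $a_0=a_1=a_2=a_3=a_4=1$ and $a_n=\dfrac{a_{n-1}a_{n-4}+a_{n-2}a_{n-3}}{a_{n-5}}$ for $n\ge 5$. Then for every $n\ge 5$ one has $a_{n-1}a_{n-4}+a_{n-2}a_{n-3}\equiv 0 \pmod{a_{n-5}}$, and consequently every $a_n$ $(n\ge 0)$ is a natural number.
   Context: The Somos-5 sequence is a priori a sequence of positive rational numbers given by the stated recursion; its first terms, starting with $a_0$, are $1,1,1,1,1,2,3,5,11,37,83,274,\dots$. Natural numbers here are positive integers. The congruence means that, all terms involved being integers, $a_{n-5}$ divides $a_{n-1}a_{n-4}+a_{n-2}a_{n-3}$ in the integers. *)

(* Defs.v *)
From mathcomp Require Import all_boot all_order all_algebra.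
Set Implicit Arguments.
Unset Strict Implicit.
Unset Printing Implicit Defensive.
Import GRing.Theory.
Local Open Scope ring_scope.

(* Rational-valued, so that integrality is not built into the definition; the
   division is the total one of [rat] (x / 0 = 0), but every term is positive.
   If the argument is n, the pattern binds nK to n - K. *)
Fixpoint somos5 (n : nat) : rat :=
  match n with
  | ((((n5.+1 as n4).+1 as n3).+1 as n2).+1 as n1).+1 =>
      (somos5 n1 * somos5 n4 + somos5 n2 * somos5 n3) / somos5 n5
  | _ => 1
  end.

Lemma somos5_init (n : nat) : (n < 5)%N -> somos5 n = 1.
Proof. by case: n => [|[|[|[|[|n]]]]]. Qed.

Lemma somos5_rec (n : nat) : (5 <= n)%N ->
  somos5 n =
    (somos5 (n - 1) * somos5 (n - 4) + somos5 (n - 2) * somos5 (n - 3))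
    / somos5 (n - 5).
Proof.
case: n => [|[|[|[|[|n]]]]] // _.
by rewrite !subSS !subn0.
Qed.

(* Main.v *)
Require Import Defs.
From mathcomp Require Import all_boot all_order all_algebra.
From mathcomp Require Import ring.
Local Open Scope ring_scope.
Set Implicit Arguments.
Unset Strict Implicit.

(** The proof runs in the natural numbers: [somos5_nat] obeys the same
    recursion with Euclidean division, and the point is that this division is
    exact.  Write a_n for its terms, and suppose the divisions were exact so
    far, so that a_{n+5} a_n = a_{n+4} a_{n+1} + a_{n+3} a_{n+2} holds for the
    indices already reached.

    Two facts follow from these relations.  Terms whose indices differ by at
    most three are coprime ([coprime_window_step]): a common prime factor of
    the new term and one of its three predecessors divides one of the two products
    in the relation, hence also the other, whose factors are already known to be
    coprime to that predecessor.  And the quotient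
      (a_{n+4} a_n + a_{n+2}^2) / (a_{n+3} a_{n+1})
    is unchanged by n -> n + 2 ([somos5_invariant_step]); for the given initial
    values it alternates between 2 and 3.

    Now let p = a_{n+3} be the next divisor.  Modulo p, each relation in which
    p occurs on the right loses a product.  Multiplying the dividend
    a_{n+7} a_{n+4} + a_{n+6} a_{n+5} by a_{n+2} a_{n+1} a_n, the three
    relations with indices n, n + 1, n + 2, applied in turn to a_{n+7} a_{n+2},
    a_{n+6} a_{n+1} and a_{n+5} a_n, leave a multiple of
    a_{n+4} a_n + a_{n+2}^2, which the invariant makes a multiple
    of p ([somos5_dvd_mul]).  As p is coprime to the three factors introduced,
    it divides the dividend itself. *)

(** * The local algebra of the recursion *)

Definition somos5_rel (a0 a1 a2 a3 a4 a5 : nat) : Prop :=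
  (a5 * a0 = a4 * a1 + a3 * a2)%N.

(** Coprimality at distances one to three: it propagates along the recursion
    without reference to larger distances, and these are the distances between
    a divisor and the factors cancelled in [somos5_dvd]. *)
Definition coprime_window (a0 a1 a2 a3 a4 : nat) : bool :=
  [&& coprime a0 a1, coprime a0 a2, coprime a0 a3,
      coprime a1 a2, coprime a1 a3, coprime a1 a4,
      coprime a2 a3, coprime a2 a4 & coprime a3 a4].

(** Modulo m the product c * d is y, a unit, so its factor c is a unit too.
    Either product in the relation can take the role of x. *)
Lemma coprime_of_mul_eq_add (m c d x y : nat) :
  (c * d = x + y)%N -> (m %| x)%N -> coprime m y -> coprime m c.
Proof.
move=> E mx cy; have : coprime m (c * d).
  by rewrite /coprime E gcdnC -gcdn_modl -modnDml (eqP mx) add0n gcdn_modl gcdnC.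
by rewrite coprimeMr => /andP[].
Qed.

Lemma coprime_window_step (a0 a1 a2 a3 a4 a5 : nat) :
  somos5_rel a0 a1 a2 a3 a4 a5 ->
  coprime_window a0 a1 a2 a3 a4 -> coprime_window a1 a2 a3 a4 a5.
Proof.
move=> E /and5P[_ _ _ c12 /and5P[c13 c14 c23 c24 c34]].
have E' : (a5 * a0 = a3 * a2 + a4 * a1)%N by rewrite addnC.
have c25 : coprime a2 a5.
  by apply: coprime_of_mul_eq_add E' _ _;
     rewrite ?dvdn_mull // coprimeMr c24 coprime_sym.
have c35 : coprime a3 a5.
  by apply: coprime_of_mul_eq_add E' _ _;
     rewrite ?dvdn_mulr // coprimeMr c34 coprime_sym.
have c45 : coprime a4 a5.
  by apply: coprime_of_mul_eq_add E _ _;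
     rewrite ?dvdn_mulr // coprimeMr !(coprime_sym a4) c34.
by rewrite /coprime_window c12 c13 c14 c23 c24 c25 c34 c35 c45.
Qed.

(** After multiplication by a1, the relation for a6 turns the left side into
    a5 * a2^2 + a4 * (a3 * a2 + a4 * a1), and the relation for a5 contracts the
    bracket to a5 * a0, so that a5 factors out. *)
Lemma somos5_invariant_step (k a0 a1 a2 a3 a4 a5 a6 : nat) :
  (0 < a1)%N ->
  somos5_rel a0 a1 a2 a3 a4 a5 -> somos5_rel a1 a2 a3 a4 a5 a6 ->
  (a4 * a0 + a2 ^ 2 = k * (a3 * a1))%N ->
  (a6 * a2 + a4 ^ 2 = k * (a5 * a3))%N.
Proof.
move=> a1_gt0 E5 E6 K; apply/eqP; rewrite -(eqn_pmul2r a1_gt0); apply/eqP.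
have -> : ((a6 * a2 + a4 ^ 2) * a1 = (a6 * a1) * a2 + a4 ^ 2 * a1)%N by ring.
have -> : (k * (a5 * a3) * a1 = a5 * (k * (a3 * a1)))%N by ring.
rewrite E6 -K.
have -> : ((a5 * a2 + a4 * a3) * a2 + a4 ^ 2 * a1
           = a5 * a2 ^ 2 + a4 * (a4 * a1 + a3 * a2))%N by ring.
by rewrite -E5; ring.
Qed.

(** Modulo a3 the relations read a7 * a2 = a5 * a4, a6 * a1 = a5 * a2 and
    a5 * a0 = a4 * a1.  Used in this order, they reduce the product to
    a5 * a4 * a1 * (a4 * a0 + a2^2), which the invariant makes a multiple of a3.
    The explicit quotient below collects the multiples of a3 dropped on the
    way. *)
Lemma somos5_dvd_mul (k a0 a1 a2 a3 a4 a5 a6 a7 : nat) :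
  somos5_rel a0 a1 a2 a3 a4 a5 -> somos5_rel a1 a2 a3 a4 a5 a6 ->
  somos5_rel a2 a3 a4 a5 a6 a7 ->
  (a4 * a0 + a2 ^ 2 = k * (a3 * a1))%N ->
  (a3 %| a2 * (a1 * (a0 * (a7 * a4 + a6 * a5))))%N.
Proof.
move=> E5 E6 E7 K.
have -> : (a2 * (a1 * (a0 * (a7 * a4 + a6 * a5)))
  = (a7 * a2) * a4 * a1 * a0 + (a6 * a1) * a5 * a2 * a0)%N by ring.
rewrite E7 E6.
have -> : ((a6 * a3 + a5 * a4) * a4 * a1 * a0
           + (a5 * a2 + a4 * a3) * a5 * a2 * a0
  = a3 * (a6 * a4 * a1 * a0 + a4 * a5 * a2 * a0)
    + a5 * (a4 ^ 2 * a1 * a0 + (a5 * a0) * a2 ^ 2))%N by ring.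
rewrite E5.
have -> : (a4 ^ 2 * a1 * a0 + (a4 * a1 + a3 * a2) * a2 ^ 2
  = a4 * a1 * (a4 * a0 + a2 ^ 2) + a3 * a2 ^ 3)%N by ring.
rewrite K; apply/dvdnP.
by exists (a6 * a4 * a1 * a0 + a4 * a5 * a2 * a0
        + a5 * (a4 * a1 * k * a1 + a2 ^ 3))%N; ring.
Qed.

Lemma somos5_dvd (k a0 a1 a2 a3 a4 a5 a6 a7 : nat) :
  coprime_window a0 a1 a2 a3 a4 ->
  somos5_rel a0 a1 a2 a3 a4 a5 -> somos5_rel a1 a2 a3 a4 a5 a6 ->
  somos5_rel a2 a3 a4 a5 a6 a7 ->
  (a4 * a0 + a2 ^ 2 = k * (a3 * a1))%N ->
  (a3 %| a7 * a4 + a6 * a5)%N.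
Proof.
move=> /and5P[_ _ c03 _ /and5P[c13 _ c23 _ _]] E5 E6 E7 K.
have := somos5_dvd_mul E5 E6 E7 K.
by rewrite !Gauss_dvdr // coprime_sym.
Qed.

(** * The sequence of natural numbers *)

Fixpoint somos5_nat (n : nat) : nat :=
  match n with
  | ((((n5.+1 as n4).+1 as n3).+1 as n2).+1 as n1).+1 =>
      (somos5_nat n1 * somos5_nat n4 + somos5_nat n2 * somos5_nat n3)
        %/ somos5_nat n5
  | _ => 1
  end.

Definition somos5_exact (n : nat) : Prop :=
  somos5_rel (somos5_nat n) (somos5_nat n.+1) (somos5_nat n.+2)
    (somos5_nat n.+3) (somos5_nat n.+4) (somos5_nat n.+4.+1).

Lemma somos5_nat_exact_of_dvd (n : nat) :
  (somos5_nat n %| somos5_nat n.+4 * somos5_nat n.+1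
                   + somos5_nat n.+3 * somos5_nat n.+2)%N ->
  somos5_exact n.
Proof. exact: divnK. Qed.

Lemma somos5_nat_gt0_below (n : nat) :
  (forall m, (m < n)%N -> somos5_exact m) ->
  [&& 0 < somos5_nat n, 0 < somos5_nat n.+1, 0 < somos5_nat n.+2,
      0 < somos5_nat n.+3 & 0 < somos5_nat n.+4]%N.
Proof.
elim: n => [//|n IHn] ex.
have /and5P[p0 p1 p2 p3 p4] := IHn (fun m h => ex m (leqW h)).
have : (0 < somos5_nat n.+4.+1 * somos5_nat n)%N.
  by rewrite (ex n (ltnSn n)) addn_gt0 muln_gt0 p4 p1.
by rewrite muln_gt0 => /andP[p5 _]; apply/and5P.
Qed.

Lemma somos5_nat_coprime_below (n : nat) :
  (forall m, (m < n)%N -> somos5_exact m) ->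
  coprime_window (somos5_nat n) (somos5_nat n.+1) (somos5_nat n.+2)
    (somos5_nat n.+3) (somos5_nat n.+4).
Proof.
elim: n => [//|n IHn] ex.
apply: coprime_window_step (ex n (ltnSn n)) _.
exact: IHn (fun m h => ex m (leqW h)).
Qed.

Lemma somos5_nat_invariant_below (n : nat) :
  (forall m, (m < n)%N -> somos5_exact m) ->
  (somos5_nat n.+4 * somos5_nat n + somos5_nat n.+2 ^ 2
   = (2 + odd n) * (somos5_nat n.+3 * somos5_nat n.+1))%N.
Proof.
elim/ltn_ind: n => -[|[|n]] IHn ex //.
have ex_n m : (m < n)%N -> somos5_exact m by move=> h; apply/ex/leqW/leqW.
have /and5P[_ p1 _ _ _] := somos5_nat_gt0_below ex_n.
rewrite [odd _]/= negbK.
by apply: somos5_invariant_step p1 (ex n _) (ex n.+1 _) (IHn n _ ex_n).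
Qed.

Lemma somos5_nat_exact (n : nat) : somos5_exact n.
Proof.
(* The divisibility argument reaches three terms below the divisor; the first
   three divisions are by 1. *)
elim/ltn_ind: n => -[|[|[|n]]] ex //.
have ex_n m : (m < n)%N -> somos5_exact m by move=> h; apply/ex/leqW/leqW/leqW.
apply: somos5_nat_exact_of_dvd.
apply: somos5_dvd (somos5_nat_coprime_below ex_n) (ex n _) (ex n.+1 _)
  (ex n.+2 _) (somos5_nat_invariant_below ex_n) => //.
by rewrite ltnS; apply/leqW/leqW.
Qed.

Lemma somos5_nat_gt0 (n : nat) : (0 < somos5_nat n)%N.
Proof.
by have /and5P[] := somos5_nat_gt0_below (fun m (_ : (m < n)%N) =>
  somos5_nat_exact m).
Qed.

(** * Comparison with the rational sequence *)

Lemma somos5E (n : nat) : somos5 n = (somos5_nat n)%:R.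
Proof.
elim/ltn_ind: n => n IHn; have [n_lt5|n_ge5] := ltnP n 5.
  by rewrite somos5_init //; case: n n_lt5 {IHn} => [|[|[|[|[|]]]]].
case: n n_ge5 IHn => [|[|[|[|[|n]]]]] // _ IHn.
rewrite somos5_rec // !subSS !subn0 !IHn ?ltnS ?leqW //.
rewrite -!GRing.natrM -GRing.natrD -(somos5_nat_exact n) GRing.natrM.
by rewrite GRing.mulfK // Num.Theory.pnatr_eq0 -lt0n somos5_nat_gt0.
Qed.

Theorem theorem2 :
  (forall n : nat, (5 <= n)%N ->
     exists x1 x2 x3 x4 x5 : int,
       [/\ somos5 (n - 1) = x1%:~R, somos5 (n - 2) = x2%:~R,
           somos5 (n - 3) = x3%:~R, somos5 (n - 4) = x4%:~R &
           somos5 (n - 5) = x5%:~R] /\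
       (x1 * x4 + x2 * x3 = 0 %[mod x5])%Z) /\
  (forall n : nat, exists k : nat, (0 < k)%N /\ somos5 n = k%:R).
Proof.
split=> n; last by exists (somos5_nat n); rewrite somos5_nat_gt0 somos5E.
case: n => [|[|[|[|[|n]]]]] // _; rewrite !subSS !subn0 !somos5E.
exists (somos5_nat n.+4 : int), (somos5_nat n.+3 : int),
  (somos5_nat n.+2 : int), (somos5_nat n.+1 : int), (somos5_nat n : int).
split; first by split.
rewrite -!PoszM -PoszD -(somos5_nat_exact n) PoszM.
by rewrite intdiv.modzMl intdiv.mod0z.
Qed.
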